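(* Let $A\subset\mathbb{N}$ be infinite and co-infinite. Then the two-point represented space $D_A$ is computably discrete.
   Context: A represented space $\mathbf{X}=(X,\delta_{\mathbf{X}})$ is a set $X$ with a partial surjection $\delta_{\mathbf{X}}:\subseteq\mathbb{N}^{\mathbb{N}}\to X$; any $p$ with $\delta_{\mathbf X}(p)=x$ is a name of $x$. A map $f:\mathbf{X}\to\mathbf{Y}$ is computable if some computable partial map on $\mathbb{N}^{\mathbb{N}}$ sends every name of every $x\in X$ to a name of $f(x)$. In the product $\mathbf{X}\times\mathbf{Y}$, $p$ names $(x,y)$ iff $n\mapsto p(2n)$ names $x$ and $n\mapsto p(2n+1)$ names $y$. Sierpinski space $\mathbb{S}=\{\top,\bot\}$ is represented so that $0^\omega$ names $\bot$ and every other sequence names $\top$. A subset of $\mathbf{X}$ is computably open if its characteristic function $\mathbf{X}\to\mathbb{S}$ (value $\top$ exactly on the set) is computable. $\mathbf{X}$ is computably discrete if the diagonal $\{(x,x)\}\subseteq\mathbf{X}\times\mathbf{X}$ is computably open. For an infinite and co-infinite $A\subset\mathbb{N}$, $D_A$ is the represented space with underlying set $\{a,b\}$ (two distinct points) where $p$ is a name for $a$ iff $p$ is obtained from the characteristic function of $A$ by replacing finitely many $1$s with $0$s, and $p$ is a name for $b$ iff it is obtained from the characteristic function of $\mathbb{N}\setminus A$ by replacing finitely many $1$s with $0$s. *)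

(* Defs.v *)
From mathcomp Require Import all_boot.
From mathcomp Require Import boolp classical_sets functions cardinality.

Set Implicit Arguments.
Unset Strict Implicit.
Unset Printing Implicit Defensive.

Local Open Scope classical_set_scope.

Definition baire := nat -> nat.

(* Computability on Baire space is Kleene's: [orec n] is the syntax of the
   n-ary partial recursive functions relative to an oracle in [baire]. *)
Inductive orec : nat -> Type :=
| Oracle : orec 1
| Zero n : orec n
| Succ : orec 1
| Proj n (i : 'I_n) : orec n
| Comp k n (f : orec k) (g : 'I_k -> orec n) : orec n
| PrimRec n (f : orec n) (g : orec n.+2) : orec n.+1
| Mu n (f : orec n.+1) : orec n.

(* [eval p e a v]: with oracle [p] and arguments [a], [e] halts with value [v].
   [PrimRec f g] recurses on its first argument:
     h(0, a) = f(a)   and   h(i + 1, a) = g(i, h(i, a), a),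
   the sequence [s] below listing h(0, a), h(1, a), ...
   [Mu f] is the least [v] with f(v, a) = 0, where f(i, a) must be defined
   for every i < v. *)
Fixpoint eval (p : baire) n (e : orec n) : n.-tuple nat -> nat -> Prop :=
  match e in orec n return n.-tuple nat -> nat -> Prop with
  | Oracle => fun a v => v = p (thead a)
  | Zero _ => fun _ v => v = 0
  | Succ => fun a v => v = (thead a).+1
  | Proj _ i => fun a v => v = tnth a i
  | Comp k _ f g => fun a v =>
      exists2 b : k.-tuple nat,
        forall i, eval p (g i) a (tnth b i) & eval p f b v
  | PrimRec _ f g => fun a v =>
      exists s : nat -> nat,
        [/\ eval p f (behead_tuple a) (s 0),
            forall i, i < thead a ->
              eval p g (cons_tuple i (cons_tuple (s i) (behead_tuple a)))
                       (s i.+1)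
          & v = s (thead a)]
  | Mu _ f => fun a v =>
      eval p f (cons_tuple v a) 0 /\
      forall i, i < v -> exists w, eval p f (cons_tuple i a) w.+1
  end.

Lemma eval_det p n (e : orec n) a v w : eval p e a v -> eval p e a w -> v = w.
Proof.
elim: e a v w => /=.
- by move=> a v w -> ->.
- by move=> ? a v w -> ->.
- by move=> a v w -> ->.
- by move=> ? i a v w -> ->.
- move=> k m f IHf g IHg a v w [b gb fb] [c gc fc].
  suff bc : b = c by rewrite bc in fb; exact: IHf fb fc.
  by apply: eq_from_tnth => i; exact: IHg (gb i) (gc i).
- move=> m f IHf g IHg a v w [s [s0 sS ->]] [t [t0 tS ->]].
  suff st i : i <= thead a -> s i = t i by exact: st.
  elim: i => [_|i IHi ia]; first exact: IHf s0 t0.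
  by apply: IHg (sS i ia) _; rewrite IHi ?(ltnW ia)//; exact: tS.
- move=> m f IHf a v w [fv lv] [fw lw].
  case: (ltngtP v w) => // [/lw|/lv] [u fu].
  + by have := IHf _ _ _ fv fu.
  + by have := IHf _ _ _ fw fu.
Qed.

(* A partial map on Baire space is computable when one oracle program outputs
   F(p)(n) on input n, for every p in the domain of F; nothing is required of
   the program outside this domain. *)
Definition computable_partial (F : baire -> option baire) : Prop :=
  exists e : orec 1,
    forall p q, F p = Some q -> forall n, eval p e [tuple n] (q n).

(* [names p x] is the graph of the partial surjection delta: delta(p) = x. *)
Record repSpace := RepSpace {
  carrier :> Type;
  names : baire -> carrier -> Prop;
  names_fun : forall p x y, names p x -> names p y -> x = y;
  names_surj : forall x, exists p, names p x }.

Definition computable_map (X Y : repSpace) (f : X -> Y) : Prop :=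
  exists2 F : baire -> option baire, computable_partial F &
    forall p (x : X), names p x -> exists2 q, F p = Some q & names q (f x).

Section Product.
Variables X Y : repSpace.

Definition prod_names (p : baire) (z : X * Y) : Prop :=
  names (fun n => p n.*2) z.1 /\ names (fun n => p n.*2.+1) z.2.

Lemma prod_names_fun p z t : prod_names p z -> prod_names p t -> z = t.
Proof.
move: z t => [x y] [x' y'] [/= px py] [/= px' py'].
by rewrite (names_fun px px') (names_fun py py').
Qed.

Lemma prod_names_surj z : exists p, prod_names p z.
Proof.
have [p px] := names_surj z.1; have [q qy] := names_surj z.2.
exists (fun n => if odd n then q n./2 else p n./2); split.
- suff -> : (fun n => if odd n.*2 then q n.*2./2 else p n.*2./2) = p by [].
  by apply/funext => n; rewrite odd_double doubleK.
- rewrite [X in names X _](_ : _ = q)//.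
  by apply/funext => n; rewrite /= odd_double /= uphalf_double.
Qed.

Definition prod_space : repSpace := RepSpace prod_names_fun prod_names_surj.

End Product.

(* Sierpinski space, with [true] for top and [false] for bottom. *)
Definition sierpinski_names (p : baire) (s : bool) : Prop :=
  if s then p <> (fun=> 0) else p = (fun=> 0).

Lemma sierpinski_names_fun p s t :
  sierpinski_names p s -> sierpinski_names p t -> s = t.
Proof. by case: s t => -[]. Qed.

Lemma sierpinski_names_surj s : exists p, sierpinski_names p s.
Proof.
case: s; last by exists (fun=> 0).
by exists (fun=> 1) => /(congr1 (@^~ 0)).
Qed.

Definition sierpinski : repSpace :=
  RepSpace sierpinski_names_fun sierpinski_names_surj.

Definition computably_open (X : repSpace) (U : set X) : Prop :=
  computable_map (fun x : X => (x \in U) : sierpinski).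

Definition computably_discrete (X : repSpace) : Prop :=
  @computably_open (prod_space X X) [set z | z.1 = z.2].

Definition char_fun (A : set nat) : baire := fun n => nat_of_bool (n \in A).

(* [p] arises from the characteristic function of [A] by replacing the 1s at
   the positions in a finite set [F] with 0s. *)
Definition char_upto_deletion (A : set nat) (p : baire) : Prop :=
  exists F : set nat, [/\ finite_set F, F `<=` A &
    p = (fun n => if n \in F then 0 else char_fun A n)].

Inductive two_points := pt_a | pt_b.

Definition D_names (A : set nat) (p : baire) (x : two_points) : Prop :=
  match x with
  | pt_a => char_upto_deletion A p
  | pt_b => char_upto_deletion (~` A) p
  end.

Lemma char_fun_upto_deletion A : char_upto_deletion A (char_fun A).
Proof.
exists set0; split; [exact: finite_set0 | exact: sub0set |].
by apply/funext => n; rewrite in_set0.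
Qed.

Lemma char_upto_deletion_disjoint (A : set nat) p : infinite_set A ->
  char_upto_deletion A p -> char_upto_deletion (~` A) p -> False.
Proof.
move=> infA [F [finF _ ->]] [G [_ _ FG]]; apply: infA.
apply: sub_finite_set finF => n An; apply: contrapT => nF.
move: (congr1 (@^~ n) FG); rewrite /char_fun /= memNset// mem_set//.
by rewrite (@memNset _ (~` A))//=; case: ifP.
Qed.

Lemma D_names_fun (A : set nat) (infA : infinite_set A) p x y :
  D_names A p x -> D_names A p y -> x = y.
Proof.
by case: x y => -[] //= h k; [case: (char_upto_deletion_disjoint infA h k)
  | case: (char_upto_deletion_disjoint infA k h)].
Qed.

Lemma D_names_surj A x : exists p, D_names A p x.
Proof.
case: x; [exists (char_fun A) | exists (char_fun (~` A))];
  exact: char_fun_upto_deletion.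
Qed.

Definition D_space (A : set nat) (infA : infinite_set A)
    (infCA : infinite_set (~` A)) : repSpace :=
  RepSpace (D_names_fun infA) (D_names_surj A).

(* Main.v *)
Require Import Defs.
From mathcomp Require Import all_boot.
From mathcomp Require Import boolp classical_sets functions cardinality.

Local Open Scope classical_set_scope.

(** Deleting finitely many points from an infinite set twice leaves an infinite
    set, so two names of the same point are simultaneously nonzero somewhere,
    whereas names of the two different points never are. Searching for a common
    nonzero position therefore semidecides equality. *)

Definition comp1 {n} (f : orec 1) (g : orec n) : orec n :=
  Comp f (fun _ : 'I_1 => g).

Definition comp2 {n} (f : orec 2) (g h : orec n) : orec n :=
  Comp f (tnth [tuple g; h]).

Lemma eval_comp1 {p n} {f : orec 1} {g : orec n} {a u v} :
  eval p g a u -> eval p f [tuple u] v -> eval p (comp1 f g) a v.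
Proof.
move=> gu fv; exists [tuple u] => // i.
by rewrite (ord1 i) tnth0.
Qed.

Lemma eval_comp2 {p n} {f : orec 2} {g h : orec n} {a u w v} :
  eval p g a u -> eval p h a w -> eval p f [tuple u; w] v ->
  eval p (comp2 f g h) a v.
Proof.
move=> gu hw fv; exists [tuple u; w] => // -[[|[|//]] i2].
(* Passing to [nth] lets the lookup compute at a literal index; the defaults are never reached. *)
- by rewrite !(tnth_nth (Zero n)) (tnth_nth 0).
- by rewrite !(tnth_nth (Zero n)) (tnth_nth 0).
Qed.

Definition orec_double : orec 1 :=
  PrimRec (Zero 0) (comp1 Succ (comp1 Succ (Proj (lift ord0 (@ord0 0))))).

Lemma eval_double p n : eval p orec_double [tuple n] n.*2.
Proof.
exists double; split=> // i _.
(* The projection at index 1 returns the previous value [i.*2]; the two successors pass through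
   [i.*2.+1]. *)
apply: (@eval_comp1 _ _ _ _ _ i.*2.+1) => //.
exact: (@eval_comp1 _ _ _ _ _ i.*2).
Qed.

(** Stands in for the product [m * n]: it has the same zeros, and a single recursion with a
    projection as its step computes it. *)
Definition guard (m n : nat) : nat := if m is 0 then 0 else n.

(* The recursion value is discarded: h(0, n) = 0 and h(i + 1, n) = n. *)
Definition orec_guard : orec 2 :=
  PrimRec (Zero 1) (Proj (lift ord0 (lift ord0 (@ord0 0)))).

Lemma eval_guard p m n : eval p orec_guard [tuple m; n] (guard m n).
Proof. by exists (guard^~ n); split. Qed.

(** The search needs no [Mu]: output [n] tests position [n] alone, and one nonzero output already
    makes the sequence a name of top. *)
Definition common_nonzero (p : baire) : baire :=
  fun n => guard (p n.*2) (p n.*2.+1).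

Lemma computable_common_nonzero : computable_partial (Some \o common_nonzero).
Proof.
exists (comp2 orec_guard (comp1 Oracle orec_double)
  (comp1 Oracle (comp1 Succ orec_double))) => p _ [<-] n.
have dbl := eval_double p n.
apply: eval_comp2; last exact: eval_guard.
- exact: (eval_comp1 dbl).
- by apply: eval_comp1 => //; exact: (eval_comp1 dbl).
Qed.

Lemma guard_eq0 m n : (guard m n == 0) = (m == 0) || (n == 0).
Proof. by case: m. Qed.

Lemma common_nonzero_neq0P {p} :
  common_nonzero p <> (fun=> 0) <-> exists n, p n.*2 <> 0 /\ p n.*2.+1 <> 0.
Proof.
split=> [h|[n [/eqP p1 /eqP p2]] /(congr1 (@^~ n))/eqP].
- apply: contrapT => nex; apply: h; apply/funext => n.
  apply/eqP; rewrite guard_eq0; apply: contrapT => /negP.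
  by rewrite negb_or => /andP[/eqP p1 /eqP p2]; apply: nex; exists n.
- by rewrite guard_eq0 (negbTE p1) (negbTE p2).
Qed.

Lemma char_upto_deletion_subset {A p n} :
  char_upto_deletion A p -> p n <> 0 -> A n.
Proof.
move=> [F [_ _ ->]]; rewrite /char_fun; case: ifP => // _.
by case: (boolP (n \in A)) => // /set_mem.
Qed.

(** Inside [A], zeros occur only at deleted positions. *)
Lemma char_upto_deletion_cofinite {A p} : char_upto_deletion A p ->
  finite_set (A `&` [set n | p n = 0]).
Proof.
move=> [F [finF _ ->]]; apply: (sub_finite_set _ finF) => n [An] /=.
by rewrite /char_fun (mem_set An); case: ifP => // /set_mem.
Qed.

Lemma char_upto_deletion_meet {A p q} : infinite_set A ->
  char_upto_deletion A p -> char_upto_deletion A q ->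
  exists n, p n <> 0 /\ q n <> 0.
Proof.
move=> infA Ap Aq.
apply: contrapT => nex; apply: infA.
(* Without a common nonzero position, the zeros of [p] and of [q] would cover [A] by two finite
   sets. *)
have finU : finite_set ((A `&` [set n | p n = 0]) `|` (A `&` [set n | q n = 0])).
  by rewrite finite_setU; split; exact: char_upto_deletion_cofinite.
apply: (sub_finite_set _ finU) => n An.
have [p0|pn0] := pselect (p n = 0); first by left.
have [q0|qn0] := pselect (q n = 0); first by right.
by case: nex; exists n.
Qed.

Lemma D_names_meetP {A} (infA : infinite_set A) (infCA : infinite_set (~` A))
    {p q x y} : D_names A p x -> D_names A q y ->
  (exists n, p n <> 0 /\ q n <> 0) <-> x = y.
Proof.
move=> px qy; split=> [[n [pn qn]]|xy].
- by case: x y px qy => -[] //= px qy;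
    have := char_upto_deletion_subset px pn;
    have := char_upto_deletion_subset qy qn.
(* Both names come from the same infinite set: [A] for [pt_a], its complement for [pt_b]. *)
- rewrite -{}xy in qy; case: x px qy => px qx;
    exact: char_upto_deletion_meet px qx.
Qed.

Theorem mainTheorem8 (A : set nat) (infA : infinite_set A)
    (infCA : infinite_set (~` A)) :
  computably_discrete (D_space infA infCA).
Proof.
exists (Some \o common_nonzero); first exact: computable_common_nonzero.
move=> p [x y] [px qy]; exists (common_nonzero p) => //.
have meetP := D_names_meetP infA infCA px qy.
rewrite /= /sierpinski_names; case: ifP => [/set_mem xy|/negbT/negP nxy].
- exact/common_nonzero_neq0P/meetP.
(* Bottom has the zero sequence as its only name, so any nonzero output must be refuted. *)
- apply: contrapT => /common_nonzero_neq0P/meetP xy.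
  by apply: nxy; apply/mem_set.
Qed.
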